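(* Let $\mathcal{F}$ be the collection of all densities $f$ supported on $[0,1]$ for which $V(f:0,1)$ is finite. There is no density estimation scheme that is $L_1$ consistent for $$\Omega=\bigcup_{f\in\mathcal{F}}\Omega(f).$$ In particular, there is no universal density estimation scheme for individual sequences, i.e. no density estimation scheme is $L_1$ consistent for the set $\Omega^*$ of all stationary sequences.
   Context: A density is a function $f:\mathbb{R}\to\mathbb{R}$ that is measurable, nonnegative and has $\int_{\mathbb{R}} f\,dx=1$; write $\mu_f(A)=\int_A f(x)\,dx$. An infinite sequence $\mathbf{x}=(x_1,x_2,\ldots)$ of real numbers has limiting density $f$ if $\frac1n\sum_{i=1}^n I\{x_i\in A\}\to\mu_f(A)$ as $n\to\infty$ for every interval $A\subseteq\mathbb{R}$. $\Omega(f)$ denotes the set of all sequences with limiting density $f$. A sequence having some limiting density is called stationary, and $\Omega^*$ denotes the set of all stationary sequences. Variation: for a real-valued function $h$ on $[a,b)$, $V(h:a,b)=\sup\sum_{i=1}^n|h(t_i)-h(t_{i-1})|$, the supremum being over all finite sequences $a\le t_0<\cdots<t_n<b$. A (univariate) density estimation scheme is a collection $\Phi=\{\phi_n\}_{n\ge1}$ of Borel-measurable mappings $\phi_n:\mathbb{R}\times\mathbb{R}^n\to\mathbb{R}$, written $\phi_n(x:x_1,\ldots,x_n)$; the estimates may take negative values and need not integrate to one. $\Phi$ is $L_1$ consistent for a collection $\Omega$ of stationary sequences if for each $\mathbf{x}\in\Omega$, $\int_{\mathbb{R}}|\phi_n(x:x_1,\ldots,x_n)-f(x)|\,dx\to0$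 as $n\to\infty$, where $f$ is the limiting density of $\mathbf{x}$. *)

(* Defs.v *)
From HB Require Import structures.
From mathcomp Require Import all_boot all_order all_algebra.
From mathcomp Require Import all_classical all_reals all_analysis.

Set Implicit Arguments.
Unset Strict Implicit.
Unset Printing Implicit Defensive.

Import Order.TTheory GRing.Theory Num.Theory.
Import numFieldNormedType.Exports.

Local Open Scope classical_set_scope.
Local Open Scope ring_scope.

Definition is_density (R : realType) (f : R -> R) : Prop :=
  [/\ measurable_fun [set: measurableTypeR R] f,
      (forall x, 0 <= f x) &
      (\int[lebesgue_measure]_x (f x)%:E = 1)%E].

Definition density_measure (R : realType) (f : R -> R) (A : set R) : \bar R :=
  (\int[lebesgue_measure]_(x in A) (f x)%:E)%E.

(* A sequence x_1, x_2, ... is a function x : nat -> R, with x_i stored as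
   x (i - 1). *)
Definition empirical_frequency (R : realType) (x : nat -> R) (A : set R)
    (n : nat) : R :=
  n%:R^-1 * \sum_(i < n) \1_A (x i).

(* [set` A] ranges over all intervals as A does: open, closed, half-open,
   bounded or not, degenerate. *)
Definition limiting_density (R : realType) (x : nat -> R) (f : R -> R) : Prop :=
  is_density f /\
  forall A : interval R,
    (empirical_frequency x [set` A] n)%:E @[n --> \oo]
      --> density_measure f [set` A].

Definition sequences_with_density (R : realType) (f : R -> R) :
    set (nat -> R) :=
  [set x | limiting_density x f].

Definition stationary_sequences (R : realType) : set (nat -> R) :=
  [set x | exists f : R -> R, limiting_density x f].
Arguments stationary_sequences : clear implicits.

(* Unlike the library's total_variation, the right endpoint is excluded and the
   points need not start at a. *)
Definition half_open_variation (R : realType) (h : R -> R) (a b : R) : \bar R :=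
  ereal_sup [set v : \bar R | exists (n : nat) (t : nat -> R),
    [/\ a <= t 0%N,
        (forall i : nat, (i < n)%N -> t i < t i.+1),
        t n < b &
        v = (\sum_(i < n) `|h (t i.+1) - h (t i)|)%:E]].

Definition bv_densities (R : realType) : set (R -> R) :=
  [set f | [/\ is_density f,
               (forall x, ~~ (0 <= x <= 1) -> f x = 0) &
               (half_open_variation f 0 1 < +oo)%E]].
Arguments bv_densities : clear implicits.

(* The n-th estimate sees n observations.  Schemes start at n = 1, so nothing
   is required of the component of index 0, which no limit depends on. *)
Record density_scheme (R : realType) := DensityScheme {
  estimate :> forall n : nat, R -> n.-tuple R -> R;
  measurable_estimate : forall n : nat, (0 < n)%N ->
    measurable_fun
      [set: (measurableTypeR R * n.-tuple (measurableTypeR R))%type]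
      (fun z => estimate z.1 z.2)
}.

Definition L1_consistent (R : realType) (Phi : density_scheme R)
    (Omega : set (nat -> R)) : Prop :=
  forall x : nat -> R, Omega x ->
  forall f : R -> R, limiting_density x f ->
    (\int[lebesgue_measure]_y
       `|Phi n y [tuple x i | i < n] - f y|%:E)%E @[n --> \oo] --> 0%E.

(* Main.v *)
(* Let v be the van der Corput sequence, which is uniformly distributed, and let
   f_k(x) = 1 + cos(a_k x) on [0, 1], with a_k = (k + 1) pi and distribution
   function F_k(x) = x + sin(a_k x) / a_k.  A sequence y^k in [0, 1] with
   F_k(y^k_i) = v_i has limiting density f_k, whatever finite prefix it is
   given, so a consistent scheme fed with y^k from some time on is eventually
   within 1/8 of f_k; at such a time the adversary switches to y^(k+1).  Since
   |F_k(x) - x| <= 1 / (k + 1), the spliced sequence x satisfies x_i - v_i -> 0,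
   so its limiting density is uniform.  Yet infinitely many estimates are close
   to some f_k, and f_k stays at L1 distance at least
   int cos^2(a_k x) dx = 1/2 from the uniform density. *)
Require Import Defs.
From mathcomp Require Import all_boot all_order all_algebra.
From mathcomp Require Import all_classical all_reals all_analysis.
From mathcomp Require Import measurable_realfun ring lra zify.

Set Implicit Arguments.
Unset Strict Implicit.
Unset Printing Implicit Defensive.

Import Order.TTheory GRing.Theory Num.Theory.
Import numFieldNormedType.Exports.

Local Open Scope classical_set_scope.
Local Open Scope ring_scope.

(** * The van der Corput sequence *)

(** Mirrors the binary digits of [n] at the binary point. The fuel makes the recursion on [n./2]
    structural; any fuel at least [n] gives the same value. *)
Fixpoint radical_inverse (R : realType) (fuel n : nat) : R :=
  if fuel is fuel'.+1 then ((odd n)%:R + radical_inverse R fuel' n./2) / 2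
  else 0.

Definition van_der_corput (R : realType) (n : nat) : R := radical_inverse R n n.

Section van_der_corput_discrepancy.
Variable R : realType.
Local Notation vdc := (van_der_corput R).

Lemma radical_inverse_fuel (k n : nat) :
  (n <= k)%N -> radical_inverse R k n = vdc n.
Proof.
suff H m : forall k n, (n <= k <= m)%N ->
    radical_inverse R k n = radical_inverse R m n.
  by move=> nk; rewrite /van_der_corput; symmetry; apply: H; rewrite leqnn nk.
elim: m => [|m IH] [|k'] n' nkm //=; [lia| |by rewrite (IH k' n'./2) //; lia].
have -> : n' = 0%N by lia.
by rewrite -(IH 0%N 0%N) //= addr0 mul0r.
Qed.

(** The lowest binary digit of the index decides which half of [0, 1) holds the term; within that
    half the sequence is a scaled copy of itself. *)
Lemma van_der_corput_double (b : bool) (n : nat) :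
  vdc (b + n.*2) = (b%:R + vdc n) / 2.
Proof.
have -> : vdc (b + n.*2) = radical_inverse R (n.*2).+2 (b + n.*2).
  by rewrite radical_inverse_fuel //; have := leq_b1 b; lia.
rewrite [LHS]/= oddD odd_double addbF oddb half_bit_double.
by have /= -> := @radical_inverse_fuel (n.*2).+1 n ltac:(lia).
Qed.

Lemma radical_inverse_ge0_lt1 (k n : nat) : 0 <= radical_inverse R k n < 1.
Proof.
elim: k n => [|k IH] n /=; first by lra.
by have := IH n./2; case: (odd n) => /=; lra.
Qed.

Lemma van_der_corput_ge0_lt1 (n : nat) : 0 <= vdc n < 1.
Proof. exact: radical_inverse_ge0_lt1. Qed.

Lemma sum_double (u : nat -> R) (h : nat) :
  \sum_(i < h.*2) u i =
  \sum_(i < h) u (false + i.*2)%N + \sum_(i < h) u (true + i.*2)%N.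
Proof.
elim: h => [|h IH]; first by rewrite !big_ord0 addr0.
by rewrite doubleS !big_ord_recr /= IH !add0n; ring.
Qed.

(** Induction on the number of binary digits. By self-similarity, the count below s among 2h terms
    is the count below 2s plus the count below 2s - 1 among h terms. One of these is trivially 0 or
    h, so each halving adds only the error of one leftover term. *)
Lemma van_der_corput_discrepancy (m n : nat) (s : R) : (n < 2 ^ m)%N ->
  (0 <= s -> \sum_(i < n) \1_`]-oo, s[ (vdc i) <= n%:R * s + m%:R) /\
  (s <= 1 -> n%:R * s - m%:R <= \sum_(i < n) \1_`]-oo, s[ (vdc i)).
Proof.
pose c n (s : R) : R := \sum_(i < n) \1_`]-oo, s[ (vdc i).
rewrite -/(c n s).
have c0 n' s' : s' <= 0 -> c n' s' = 0.
  move=> s0; apply: big1 => i _; rewrite indicE memNset //= in_itv /=.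
  by have := van_der_corput_ge0_lt1 i; lra.
have c1 n' s' : 1 <= s' -> c n' s' = n'%:R.
  move=> s1; rewrite /c (eq_bigr (fun=> 1)) ?sumr_const ?card_ord //= => i _.
  rewrite indicE mem_set //= in_itv /=.
  by have := van_der_corput_ge0_lt1 i; lra.
have cD h s' : c h.*2 s' = c h (2 * s') + c h (2 * s' - 1).
  rewrite /c (sum_double (fun i => \1_`]-oo, s'[ (vdc i))); congr (_ + _);
    apply: eq_bigr => i _; rewrite van_der_corput_double !indicE;
    congr (nat_of_bool _)%:R;
    by apply: asbool_equiv_eq; rewrite /= !in_itv /=; split; lra.
elim: m n s => [|m IH] n s.
  by case: n => //; rewrite /c big_ord0; split; lra.
move=> nm; pose h := n./2.
have hm : (h < 2 ^ m)%N by move: nm; rewrite expnS /h; lia.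
(* [b] is the contribution of the unpaired last term and [d] the parity of [n]; both are 0 when [n]
   is even. *)
have cn : exists b d : R, [/\ 0 <= b <= 1, 0 <= d <= 1, c n s = c h.*2 s + b &
    n%:R = h%:R * 2 + d].
  have -> : n = (odd n + h.*2)%N by rewrite odd_double_half.
  rewrite -[h.*2]muln2 natrD natrM muln2; case: (odd n) => /=.
    exists (\1_`]-oo, s[ (vdc h.*2)), 1; split; [|lra| |lra].
    - by rewrite indicE; case: (_ \in _) => /=; lra.
    - by rewrite /c /= add1n big_ord_recr.
  by exists 0, 0; rewrite ?add0n ?addr0; split; lra.
case: cn => b [d [b01 d01 -> ->]]; rewrite cD -[m.+1]addn1 natrD.
have [U1 L1] := IH h (2 * s) hm; have [U2 L2] := IH h (2 * s - 1) hm.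
have [s2|s2] := leP s (1/2).
- have c2 := c0 h (2 * s - 1) ltac:(lra); split=> s01.
    have : 0 <= d * s by apply: mulr_ge0; lra.
    by have := U1 ltac:(lra); rewrite -!/(c _ _); lra.
  have : 0 <= d * (1 - s) by apply: mulr_ge0; lra.
  by have := L1 ltac:(lra); rewrite -!/(c _ _); lra.
- have c2 := c1 h (2 * s) ltac:(lra); split=> s01.
    have : 0 <= d * s by apply: mulr_ge0; lra.
    by have := U2 ltac:(lra); rewrite -!/(c _ _); lra.
  have : 0 <= d * (1 - s) by apply: mulr_ge0; lra.
  by have := L2 ltac:(lra); rewrite -!/(c _ _); lra.
Qed.

End van_der_corput_discrepancy.

(** * Sequences driven by a distribution function *)

Lemma archimedean_natP (R : realType) (e c : R) : 0 < e ->
  exists N : nat, forall n : nat, (N <= n)%N -> c <= n%:R * e.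
Proof.
move=> e0; exists (Num.bound (`|c| / e)) => n Nn.
have cN := archi_boundP (_ : 0 <= `|c| / e).
rewrite -ler_pdivrMr //; apply: (@le_trans _ _ (`|c| / e)).
  by rewrite ler_pM2r ?invr_gt0 // ler_norm.
apply: (@le_trans _ _ (Num.bound (`|c| / e))%:R); last by rewrite ler_nat.
by apply/ltW/cN; rewrite divr_ge0 // ltW.
Qed.

(** With k = log2 n rounded down, the discrepancy is at most k + 1, and (k + 1)^2 <= 16 n <= (n e)^2
    once n e^2 >= 16. *)
Lemma van_der_corput_equidistributed (R : realType) (e : R) : 0 < e ->
  exists N : nat, forall n : nat, (N <= n)%N -> forall s : R,
    (0 <= s -> \sum_(i < n) \1_`]-oo, s[ (van_der_corput R i)
               <= n%:R * (s + e)) /\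
    (s <= 1 -> n%:R * (s - e)
               <= \sum_(i < n) \1_`]-oo, s[ (van_der_corput R i)).
Proof.
move=> e0; have e20 : 0 < e ^+ 2 by rewrite exprn_gt0.
have [N HN] := archimedean_natP 16 e20.
exists N.+1 => n Nn s; pose k := trunc_log 2 n.
have n0 : (0 < n)%N by lia.
have kn : (2 ^ k <= n)%N by rewrite trunc_logP.
have [U L] := @van_der_corput_discrepancy R k.+1 n s (@trunc_log_ltn 2 n isT).
(* The shift by 3 lets the induction close from j = 0 on: ((j + 4) / (j + 3))^2 <= 16/9 < 2. *)
have k2 : ((k + 3) ^ 2 <= 16 * 2 ^ k)%N.
  elim: (k) => [//|j]; rewrite [(2 ^ j.+1)%N]expnS -!mulnn.
  by move: (2 ^ j)%N => p IH; nia.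
suff ke : (k.+1%:R : R) <= n%:R * e.
  by split=> hs; [have := U hs|have := L hs]; lra.
have n1 : (0 : R) < n%:R by rewrite ltr0n.
rewrite -(@ler_pXn2r _ 2) ?nnegrE //; last by rewrite mulr_ge0 // ltW.
apply: (@le_trans _ _ (16 * n%:R)).
  by rewrite -natrX -natrM ler_nat; move: k2 kn; rewrite -!mulnn; nia.
have : n%:R * 16 <= n%:R * (n%:R * e ^+ 2) by rewrite ler_pM2l // HN //; lia.
rewrite exprMn; lra.
Qed.

(** Only the first N terms can exceed their bound, by at most N C in total, which n e absorbs for
    large n. *)
Lemma sum_eventually_le (R : realType) (a b : nat -> R) (C e : R) (N : nat) :
  0 <= C -> (forall i, a i <= b i + C) ->
  (forall i, (N <= i)%N -> a i <= b i) -> 0 < e ->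
  exists M : nat, forall n : nat, (M <= n)%N ->
    \sum_(i < n) a i <= \sum_(i < n) b i + n%:R * e.
Proof.
move=> C0 abC ab e0; have [M HM] := archimedean_natP (N%:R * C) e0.
exists M => n /HM NC.
suff : \sum_(i < n) a i <= \sum_(i < n) b i + (minn n N)%:R * C.
  have : (minn n N)%:R * C <= N%:R * C by rewrite ler_wpM2r // ler_nat geq_minr.
  lra.
elim: n {NC} => [|n IH]; first by rewrite min0n !big_ord0 mul0r addr0.
rewrite !big_ord_recr /=; have [nN|Nn] := ltnP n N.
  have -> : minn n.+1 N = (minn n N).+1 by lia.
  by rewrite -addn1 natrD; have := abC n; lra.
have -> : minn n.+1 N = minn n N by lia.
by have := ab _ Nn; lra.
Qed.

(* [F] plays the role of a distribution function; it may fail to be injective,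
   so [y i] need not be determined by [F (y i)]. *)
Lemma empirical_frequency_quantile (R : realType) (F : R -> R) (y : nat -> R)
    (A : set R) (s t : R) :
  {homo F : a b / a <= b} -> 0 <= F s -> F t <= 1 ->
  (forall e, 0 < e -> exists N : nat, forall i, (N <= i)%N ->
     0 <= y i <= 1 /\ `|F (y i) - van_der_corput R i| <= e) ->
  s <= t ->
  (forall x, 0 <= x <= 1 -> A x -> s <= x <= t) ->
  (forall x, s < x < t -> A x) ->
  empirical_frequency y A n @[n --> \oo] --> F t - F s.
Proof.
move=> Fle Fs0 Ft1 yv st Asup Ainf.
(* Six losses of [d]: three from the margins d and 2d below, two from the two van der Corput counts,
   one from the initial terms. *)
apply/cvgrPdist_le => e e0; pose d := e / 6.
have d0 : 0 < d by rewrite /d; lra.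
have Fst := Fle _ _ st.
have [N yN] := yv _ d0.
pose c (r : R) i : R := \1_`]-oo, r[ (van_der_corput R i).
have cE r i : c r i = (van_der_corput R i < r)%R%:R.
  by rewrite /c indicE mem_setE in_itv.
have c01 r i : 0 <= c r i <= 1 by rewrite cE; case: (_ < _) => /=; lra.
have A01 i : 0 <= (\1_A (y i) : R) <= 1.
  by rewrite indicE; case: (_ \in _) => /=; lra.
(* If y_i is in A, then v_i lies in [F s - d, F t + d]; the margin 2d at the right end makes room
   for the strict inequality in [c]. *)
have upper i : (N <= i)%N ->
    \1_A (y i) <= c (F t + 2 * d) i - c (F s - d) i.
  move=> /yN[y01]; rewrite ler_norml indicE !cE => yvi.
  case: (boolP (y i \in A)) => [/set_mem/(Asup _ y01)/andP[/Fle ? /Fle ?]|_] /=;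
    case: (ltP _ (F t + _)) => h1; case: (ltP _ (F s - _)) => h2 /=; lra.
(* If F s + 2d <= v_i < F t - d, then F s < F (y_i) < F t, and monotonicity of F puts y_i strictly
   between s and t. *)
have lower i : (N <= i)%N ->
    c (F t - d) i - c (F s + 2 * d) i <= \1_A (y i).
  move=> /yN[y01]; rewrite ler_norml indicE !cE => yvi.
  case: (boolP (y i \in A)) => [_|/negP nA] /=;
    case: (ltP _ (F t - _)) => h1; case: (ltP _ (F s + _)) => h2 /=; try lra.
  exfalso; apply: nA; apply/mem_set/Ainf; apply/andP; split; rewrite ltNge;
    by apply/negP => /Fle; lra.
have [M1 HM1] := @sum_eventually_le R (fun i => \1_A (y i))
  (fun i => c (F t + 2 * d) i - c (F s - d) i) 2 d N ltac:(lra)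
  ltac:(move=> i; have := c01 (F t + 2 * d) i; have := c01 (F s - d) i;
        have := A01 i; lra) upper d0.
have [M2 HM2] := @sum_eventually_le R
  (fun i => c (F t - d) i - c (F s + 2 * d) i) (fun i => \1_A (y i)) 2 d N
  ltac:(lra)
  ltac:(move=> i; have := c01 (F t - d) i; have := c01 (F s + 2 * d) i;
        have := A01 i; lra) lower d0.
have [M3 HM3] := van_der_corput_equidistributed d0.
exists (maxn 1 (maxn M1 (maxn M2 M3))) => // n /=.
rewrite !geq_max => /and4P[n1 n2 n3 n4].
have n0 : (0 : R) < n%:R by rewrite ltr0n.
have := HM1 n n2; have := HM2 n n3.
rewrite !sumrB.
have [+ _] := HM3 n n4 (F t + 2 * d) => /(_ ltac:(lra)).
have [+ _] := HM3 n n4 (F s + 2 * d) => /(_ ltac:(lra)).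
have [_ +] := HM3 n n4 (F t - d) => /(_ ltac:(lra)).
have [_ +] := HM3 n n4 (F s - d) => /(_ ltac:(lra)).
rewrite /c => h1 h2 h3 h4 h5 h6.
rewrite /empirical_frequency -(ler_pM2l n0).
rewrite -[X in X * _ <= _](gtr0_norm n0) -normrM mulrBr.
rewrite mulrA divff ?gt_eqF // mul1r ler_norml.
have -> : e = 6 * d by rewrite /d; lra.
by apply/andP; split; lra.
Qed.

(** * Densities on the unit interval *)

(* [F] need only be a distribution function on [0, 1], where [f] is its density;
   elsewhere the density is [0], not [f]. *)
Definition smooth_cdf (R : realType) (F f : R -> R) : Prop :=
  [/\ forall x : R, is_derive x 1 F (f x), continuous f, forall x, 0 <= f x,
      F 0 = 0 & F 1 = 1].

Section smooth_cdf.
Variables (R : realType) (F f : R -> R).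
Hypothesis Ff : smooth_cdf F f.

Lemma smooth_cdf_continuous : continuous F.
Proof.
case: Ff => dF _ _ _ _ x; apply/differentiable_continuous/derivable1_diffP.
by have := dF x => -[].
Qed.

Lemma smooth_cdf_homo : {homo F : a b / a <= b}.
Proof.
move=> a b ab; have [dF _ f0 _ _] := Ff.
have [] := @MVT_segment R F f a b ab (fun x _ => dF x).
  exact/continuous_subspaceT/smooth_cdf_continuous.
by move=> c _ E; rewrite -subr_ge0 E mulr_ge0 // subr_ge0.
Qed.

Lemma integral_smooth_cdf (a b : R) : a <= b ->
  (\int[lebesgue_measure]_(x in `[a, b]) (f x)%:E = (F b - F a)%:E)%E.
Proof.
have [dF cf f0 _ _] := Ff.
rewrite le_eqVlt => /predU1P[->|ab].
  by rewrite set_itv1 integral_set1 subrr.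
rewrite (@continuous_FTC2 R f F) //.
- exact: continuous_subspaceT.
- split.
  + by move=> x _; have := dF x => -[].
  + exact/cvg_at_right_filter/smooth_cdf_continuous.
  + exact/cvg_at_left_filter/smooth_cdf_continuous.
- by move=> x _; rewrite derive1E; have := dF x => -[_ ->].
Qed.

Lemma measurable_smooth_density (A : set (measurableTypeR R)) :
  measurable_fun A (f : measurableTypeR R -> measurableTypeR R).
Proof.
apply: (@measurable_funS _ _ _ _ setT) => //.
by have [_ cf _ _ _] := Ff; apply: continuous_measurable_fun.
Qed.

(** The part of A in [0, 1] is squeezed between ]s, t[ and [s, t], which have equal mass. *)
Lemma density_measure_unit_interval (A : set R) (s t : R) :
  measurable (A : set (measurableTypeR R)) ->
  0 <= s -> s <= t -> t <= 1 ->
  (forall x, 0 <= x <= 1 -> A x -> s <= x <= t) ->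
  (forall x, s < x < t -> A x) ->
  density_measure (f \_ `[0, 1]) A = (F t - F s)%:E.
Proof.
move=> mA s0 st t1 Asup Ainf.
have [_ _ f0 _ _] := Ff.
have mf (B : set R) : measurable_fun (B : set (measurableTypeR R)) (EFin \o f).
  by apply/measurable_EFinP; exact: measurable_smooth_density.
have -> : density_measure (f \_ `[0, 1]) A =
    (\int[lebesgue_measure]_(x in A `&` `[0%R, 1%R]) (f x)%:E)%E.
  rewrite integral_mkcondr; apply: eq_integral => x _.
  by rewrite !patchE; case: ifP.
rewrite -integral_smooth_cdf //; apply/eqP; rewrite eq_le; apply/andP; split.
  apply: ge0_subset_integral => //.
  - exact: measurableI.
  - by move=> x _; rewrite lee_fin.
  - by move=> x [Ax] /=; rewrite !in_itv /= => /Asup; apply.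
rewrite (integral_itv_bndoo _ _ (mf [set` `]s, t[])).
apply: ge0_subset_integral => //.
- exact: measurableI.
- by move=> x _; rewrite lee_fin.
- move=> x /=; rewrite in_itv /= => sxt; split; first exact: Ainf.
  by rewrite /= in_itv /=; lra.
Qed.

Lemma is_density_unit_interval : is_density (f \_ `[0, 1]).
Proof.
have [_ _ f0 F0 F1] := Ff; split.
- apply: (measurable_restrictT _ (measurable_itv _)).1.
  exact: measurable_smooth_density.
- by move=> x; rewrite patchE; case: ifP.
- have := @density_measure_unit_interval setT 0 1.
  by rewrite F0 F1 subr0; apply.
Qed.

(** Each variation sum is at most L times a telescoping length, and the partition stays inside
    [0, 1], where the restriction agrees with [f]. *)
Lemma bv_density_unit_interval (L : R) :
  (forall a b, a <= b -> `|f b - f a| <= L * (b - a)) ->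
  bv_densities R (f \_ `[0, 1]).
Proof.
move=> Lf; split; first exact: is_density_unit_interval.
  by move=> x x01; rewrite patchE memNset //= in_itv /=; apply/negP.
apply: (@le_lt_trans _ _ L%:E); last exact: ltry.
apply: ge_ereal_sup => _ [n [t [t0 tS tn ->]]]; rewrite lee_fin.
have tle i j : (i <= j <= n)%N -> t i <= t j.
  move=> /andP[]; elim: j => [|j IH]; first by case: i.
  rewrite leq_eqVlt => /predU1P[-> //|ij jn].
  by apply: (le_trans (IH ij (ltnW jn))); apply/ltW/tS.
have t01 i : (i <= n)%N -> t i \in [set` `[0, 1]].
  move=> il; apply/mem_set; rewrite /= in_itv /=.
  have := tle 0%N i il; have := tle i n; rewrite il leqnn => /(_ isT); lra.
have L0 : 0 <= L.
  by have := Lf 0 1 ler01; rewrite subr0 mulr1; apply: le_trans.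
apply: (@le_trans _ _ (\sum_(i < n) L * (t i.+1 - t i))).
  apply: ler_sum => i _; have ni := ltn_ord i.
  by rewrite !patchE !t01 // 1?ltnW //; apply/Lf/ltW/tS.
rewrite -mulr_sumr -(big_mkord xpredT (fun i => t i.+1 - t i)).
rewrite telescope_sumr //.
by rewrite -[leRHS]mulr1 ler_wpM2l //; lra.
Qed.

(** Take the infimum and supremum of A within [0, 1], or s = t = 0 if that part is empty. This
    treats all kinds of intervals at once. *)
Lemma interval_unit_ends (A : interval R) : exists s t : R,
  [/\ 0 <= s, s <= t, t <= 1,
      forall x, 0 <= x <= 1 -> [set` A] x -> s <= x <= t &
      forall x, s < x < t -> [set` A] x].
Proof.
pose B : set R := [set x | x \in A /\ 0 <= x <= 1].
have [[b [bA b01]]|B0] := pselect (B !=set0); last first.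
  exists 0, 0; split => //; last by move=> x; lra.
  by move=> x x01 Ax; exfalso; apply: B0; exists x.
have supB : has_sup B by split; [exists b|exists 1 => x [_ /andP[]]].
have infB : has_inf B by split; [exists b|exists 0 => x [_ /andP[]]].
have lB x : B x -> inf B <= x by move=> Bx; apply: ge_inf => //; case: infB.
have uB x : B x -> x <= sup B by move=> Bx; apply: ub_le_sup => //; case: supB.
exists (inf B), (sup B); split.
- by apply: lb_le_inf; [case: infB|move=> x [_ /andP[]]].
- by apply: (@le_trans _ _ b); [apply: lB|apply: uB].
- by apply: ge_sup; [case: supB|move=> x [_ /andP[]]].
- by move=> x x01 Ax; rewrite lB ?uB.
- move=> x /andP[ix xs].
  have [a Ba ax] := inf_lt infB.1 ix; have [c Bc xc] := sup_gt supB.1 xs.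
  apply: (@interval_is_interval _ A a c); [exact: Ba.1|exact: Bc.1|].
  by rewrite !ltW.
Qed.

(** Applied both to sequences that are exact quantiles from some index on and, with F the identity,
    to the adversarial sequence. *)
Lemma limiting_density_unit_interval (y : nat -> R) :
  (forall e, 0 < e -> exists N : nat, forall i, (N <= i)%N ->
     0 <= y i <= 1 /\ `|F (y i) - van_der_corput R i| <= e) ->
  limiting_density y (f \_ `[0, 1]).
Proof.
move=> yv; split; first exact: is_density_unit_interval.
move=> A; have [s [t [s0 st t1 Asup Ainf]]] := interval_unit_ends A.
rewrite (density_measure_unit_interval _ s0 st t1 Asup Ainf) //.
apply: cvg_EFin; first exact: nearW.
have [_ _ _ F0 F1] := Ff.
apply: (empirical_frequency_quantile smooth_cdf_homo) => //.
- by rewrite -F0 smooth_cdf_homo.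
- by rewrite -F1 smooth_cdf_homo.
Qed.

Lemma smooth_cdf_quantile (v : R) : 0 <= v <= 1 ->
  exists2 y, 0 <= y <= 1 & F y = v.
Proof.
move=> v01; have [_ _ _ F0 F1] := Ff.
have [||y y01 Fy] := @IVT R F 0 1 v ler01.
- exact/continuous_subspaceT/smooth_cdf_continuous.
- by rewrite F0 F1 min_l // max_r.
- by exists y => //; rewrite in_itv in y01.
Qed.

End smooth_cdf.

(** * Splicing and the cosine densities *)

Definition splice (T : Type) (x : nat -> T) (n : nat) (z : nat -> T) :
    nat -> T :=
  fun i => if (i < n)%N then x i else z i.

(** Stage k keeps the sequence before the current switch time and follows [Y k] afterwards, until a
    later time at which P k holds. Subsequent stages never alter the terms before that time, so P k
    survives in the limit. *)
Lemma splice_diagonal (T : Type) (Y : nat -> nat -> T)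
    (P : nat -> (nat -> T) -> nat -> Prop) :
  (forall k x x' n, (forall i, (i < n)%N -> x i = x' i) ->
     P k x n -> P k x' n) ->
  (forall k x n, exists2 m, (n < m)%N & P k (splice x n (Y k)) m) ->
  exists x,
    (forall k, exists2 n, (k < n)%N & P k x n) /\
    (forall K, exists N, forall i, (N <= i)%N ->
       exists2 l, (K <= l)%N & x i = Y l i).
Proof.
move=> Pprefix Psplice.
have /choice[next nextP] : forall p : nat * (nat -> T) * nat, exists m,
    (p.2 < m)%N /\ P p.1.1 (splice p.1.2 p.2 (Y p.1.1)) m.
  by move=> [[k x] n]; have [m nm Pm] := Psplice k x n; exists m.
(* A state pairs the sequence built so far with the next switch time. *)
pose fix state k : (nat -> T) * nat :=
  if k is k'.+1 then
    (splice (state k').1 (state k').2 (Y k'),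
     next (k', (state k').1, (state k').2))
  else (Y 0%N, 0%N).
pose z k := (state k).1; pose t k := (state k).2.
have tS k : (t k < t k.+1)%N by have [] := nextP (k, z k, t k).
have PS k : P k (z k.+1) (t k.+1) by have [] := nextP (k, z k, t k).
have zS k i : z k.+1 i = if (i < t k)%N then z k i else Y k i by [].
have kt k : (k <= t k)%N by elim: k => // k IH; apply: leq_ltn_trans (tS k).
have tle j k : (j <= k)%N -> (t j <= t k)%N.
  elim: k => [|k IH]; first by rewrite leqn0 => /eqP ->.
  rewrite leq_eqVlt => /predU1P[-> //|jk].
  exact: leq_trans (IH jk) (ltnW (tS k)).
have zz j k i : (j <= k)%N -> (i < t j)%N -> z k i = z j i.
  elim: k => [|k IH]; first by rewrite leqn0 => /eqP ->.
  rewrite leq_eqVlt => /predU1P[->//|jk] ij.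
  by rewrite zS (leq_trans ij (tle j k jk)) IH.
(* Since i < t (i + 1), the term of index i is frozen from stage i + 1 on. *)
exists (fun i => z i.+1 i); split=> [k|K].
  exists (t k.+1); first exact: leq_trans (kt _).
  apply: Pprefix (PS k) => i ik.
  have [ki|/ltnW ik'] := leqP k.+1 i.+1; first by rewrite (zz _ _ _ ki).
  by rewrite -(zz i.+1 k.+1) //; exact: leq_trans (kt _).
exists (t K) => i Ki.
(* As i >= t K, the term was last written by some stage l >= K; induction on j locates it. *)
suff block j : (K <= j)%N -> (i < t j)%N ->
    exists2 l, (K <= l)%N & z j i = Y l i.
  apply: block; last exact: leq_trans (kt _).
  exact: leq_trans (kt K) (leq_trans Ki _).
elim: j => [|j IH].
  by rewrite leqn0 => /eqP K0; move: Ki; rewrite K0.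
rewrite leq_eqVlt => /predU1P[<-|Kj] ij.
  by move: (leq_ltn_trans Ki ij); rewrite ltnn.
rewrite zS; case: ltnP => [ij'|ji]; first exact: IH.
by exists j.
Qed.

Section cosine_densities.
Variable R : realType.

Definition frequency (k : nat) : R := k.+1%:R * pi.

Definition cosine_density (k : nat) (x : R) : R := 1 + cos (frequency k * x).

Definition cosine_cdf (k : nat) (x : R) : R :=
  x + (frequency k)^-1 * sin (frequency k * x).

Lemma frequency_ge (k : nat) : k.+1%:R <= frequency k.
Proof. by rewrite /frequency ler_peMr // (le_trans _ (pi_ge2 R)) // ler1n. Qed.

Lemma frequency_gt0 (k : nat) : 0 < frequency k.
Proof. exact: lt_le_trans (frequency_ge k). Qed.

(** Places the doubled angle of the cosine-square formula in the same family of densities. *)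
Lemma frequency_double (k : nat) : frequency k.*2.+1 = 2 * frequency k.
Proof. by rewrite /frequency -doubleS -mul2n natrM mulrA. Qed.

Lemma sin_frequency (k : nat) : sin (frequency k) = 0.
Proof.
elim: k => [|k IH]; first by rewrite /frequency mul1r sinpi.
by rewrite /frequency -natr1 mulrDl mul1r sinDpi -/(frequency k) IH oppr0.
Qed.

Lemma smooth_cdf_id : smooth_cdf (@id R) (fun=> 1).
Proof.
by split=> // x; [exact: is_derive_id|exact: cvg_cst].
Qed.

Lemma is_derive_scale (a x : R) : is_derive x 1 ( *%R a) a.
Proof.
have := is_deriveZ a (is_derive_id x 1).
by rewrite /GRing.scale /= mulr1.
Qed.

Lemma smooth_cdf_cosine (k : nat) :
  smooth_cdf (cosine_cdf k) (cosine_density k).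
Proof.
have a0 := frequency_gt0 k.
split.
- move=> x.
  have dsin := is_derive1_comp (is_derive_sin (frequency k * x))
                 (is_derive_scale (frequency k) x).
  have := is_deriveD (is_derive_id x 1) (is_deriveZ (frequency k)^-1 dsin).
  move=> /is_derive_eq; apply.
  rewrite /GRing.scale /= /cosine_density [_ * frequency k]mulrC.
  by rewrite mulKf ?gt_eqF.
- move=> x; apply: cvgD; first exact: cvg_cst.
  apply: continuous_comp; last exact: continuous_cos.
  by apply: cvgM; [exact: cvg_cst|exact: cvg_id].
- by move=> x; have := cos_geN1 (frequency k * x); rewrite /cosine_density; lra.
- by rewrite /cosine_cdf mulr0 sin0 mulr0 addr0.
- by rewrite /cosine_cdf mulr1 sin_frequency mulr0 addr0.
Qed.

(** The perturbation is a sine of amplitude 1 / a_k; faster oscillation hides it from the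
    distribution function. *)
Lemma cosine_cdf_near (k : nat) (x : R) :
  `|cosine_cdf k x - x| <= k.+1%:R^-1.
Proof.
have a0 := frequency_gt0 k.
rewrite /cosine_cdf addrC addKr normrM normfV (gtr0_norm a0).
apply: (@le_trans _ _ (frequency k)^-1).
  by rewrite ler_piMr ?invr_ge0 ?(ltW a0) // sin_max.
by rewrite lef_pV2 ?posrE // frequency_ge.
Qed.

Lemma cosine_density_bv (k : nat) :
  bv_densities R (cosine_density k \_ `[0, 1]).
Proof.
have a0 := frequency_gt0 k.
apply: (bv_density_unit_interval (smooth_cdf_cosine k) (L := frequency k)).
move=> a b ab.
have dcos (x : R) : is_derive x 1 (fun y => cos (frequency k * y))
                (- sin (frequency k * x) * frequency k).
  have := is_derive1_comp (is_derive_cos (frequency k * x))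
            (is_derive_scale (frequency k) x).
  by move=> /is_derive_eq; apply.
have [|c _ E] := MVT_segment ab (fun x _ => dcos x).
  apply: continuous_subspaceT => x.
  apply/differentiable_continuous/derivable1_diffP.
  by have := dcos x => -[].
have -> : cosine_density k b - cosine_density k a =
    - sin (frequency k * c) * frequency k * (b - a).
  by rewrite -E /cosine_density; ring.
have := sin_le1 (frequency k * c); have := sin_geN1 (frequency k * c).
set s := sin _ => s1 s2.
have ad0 : 0 <= frequency k * (b - a) by rewrite mulr_ge0 ?subr_ge0 // ltW.
(* This product and the next give the two sides of the absolute value bound. *)
have : 0 <= (1 - s) * (frequency k * (b - a)) by rewrite mulr_ge0 //; lra.
have : 0 <= (1 + s) * (frequency k * (b - a)) by rewrite mulr_ge0 //; lra.
by rewrite ler_norml; lra.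
Qed.

Definition uniform_density : R -> R := (fun=> 1 : R) \_ `[0, 1].

Lemma uniform_density_bv : bv_densities R uniform_density.
Proof.
apply: (bv_density_unit_interval smooth_cdf_id (L := 0)).
by move=> a b _; rewrite subrr normr0 mul0r.
Qed.

(** On [0, 1] the difference is |cos| >= cos^2, and cos^2 (a_k x) is half the cosine density of
    index 2k + 1, whose integral is already known to be 1. *)
Lemma cosine_density_far (k : nat) :
  ((1 / 2)%:E <= \int[lebesgue_measure]_y
     `|(cosine_density k \_ `[0%R, 1%R]) y - uniform_density y|%:E)%E.
Proof.
have [[mg g0 g1] _ _] := cosine_density_bv k.*2.+1.
have [[mf _ _] _ _] := cosine_density_bv k.
have [[mu _ _] _ _] := uniform_density_bv.
rewrite -[leLHS]mule1 -g1 -ge0_integralZl //; last 2 first.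
- exact/measurable_EFinP.
- by move=> x _; rewrite lee_fin.
apply: ge0_le_integral => //.
- by move=> x _; rewrite -EFinM lee_fin mulr_ge0.
- by apply: measurable_funeM; exact/measurable_EFinP.
- apply/measurable_EFinP; apply: measurableT_comp => //.
  exact: measurable_funB.
move=> x _; rewrite -EFinM lee_fin /uniform_density !patchE.
case: ifP => _; last first.
  by rewrite subrr normr0 mulr0.
rewrite /cosine_density frequency_double /= addrAC subrr add0r -mulrA mulr_natl.
rewrite cos_mulr2n.
set c := cos _.
have -> : 1 / 2 * (1 + (c ^+ 2 *+ 2 - 1)) = `|c| ^+ 2.
  by rewrite real_normK ?num_real //; field.
by rewrite expr2 ler_piMr // cos_max.
Qed.

Lemma cosine_quantiles : exists Y : nat -> nat -> R, forall k i : nat,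
  0 <= Y k i <= 1 /\ cosine_cdf k (Y k i) = van_der_corput R i.
Proof.
have /choice[Y HY] : forall p : nat * nat, exists y : R,
    0 <= y <= 1 /\ cosine_cdf p.1 y = van_der_corput R p.2.
  move=> p; have [|y y01 Fy] := @smooth_cdf_quantile _ _ _
    (smooth_cdf_cosine p.1) (van_der_corput R p.2).
    by have := van_der_corput_ge0_lt1 R p.2; lra.
  by exists y.
by exists (fun k i => Y (k, i)) => k i; exact: HY (k, i).
Qed.

End cosine_densities.

(** * The adversarial sequence *)

Lemma cvge0_eventually_le (R : realType) (u : nat -> \bar R) (e : R) :
  0 < e -> u n @[n --> \oo] --> 0%E ->
  exists N : nat, forall n, (N <= n)%N -> (u n <= e%:E)%E.
Proof.
move=> e0 /fine_cvgP[[N1 _ ufin] /cvgrPdist_le/(_ _ e0)[N2 _ ule]].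
exists (maxn N1 N2) => n; rewrite geq_max => /andP[n1 n2].
rewrite -(fineK (ufin n n1)) lee_fin.
by have := ule n n2; rewrite sub0r normrN /= => /(le_trans (ler_norm _)).
Qed.

Section no_consistent_scheme.
Variables (R : realType) (Phi : density_scheme R).

Definition L1_error (f : R -> R) (x : nat -> R) (n : nat) : \bar R :=
  (\int[lebesgue_measure]_y `|Phi n y [tuple x i | i < n] - f y|%:E)%E.

(** Supplies the prefix hypothesis of [splice_diagonal]: the n-th estimate sees only n terms. *)
Lemma L1_error_prefix (f : R -> R) (x x' : nat -> R) (n : nat) :
  (forall i, (i < n)%N -> x i = x' i) -> L1_error f x n = L1_error f x' n.
Proof.
move=> xx'; rewrite /L1_error.
suff -> : [tuple x i | i < n] = [tuple x' i | i < n] by [].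
by apply: eq_from_tnth => i; rewrite !tnth_mktuple xx'.
Qed.

Lemma measurable_L1_error (f : R -> R) (x : nat -> R) (n : nat) : (0 < n)%N ->
  is_density f ->
  measurable_fun [set: measurableTypeR R]
    (fun y => (`|Phi n y [tuple x i | i < n] - f y|%:E)%E).
Proof.
move=> n0 [mf _ _]; apply/measurable_EFinP; apply: measurableT_comp => //.
apply: measurable_funB => //.
exact: (measurable_fun_pair1 _ (measurable_estimate Phi n0)).
Qed.

Lemma L1_error_triangle (f g : R -> R) (x : nat -> R) (n : nat) : (0 < n)%N ->
  is_density f -> is_density g ->
  (\int[lebesgue_measure]_y `|f y - g y|%:E
   <= L1_error f x n + L1_error g x n)%E.
Proof.
move=> n0 df dg.
have mf := measurable_L1_error x n0 df; have mg := measurable_L1_error x n0 dg.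
rewrite -ge0_integralD //.
apply: ge0_le_integral => //.
- case: df dg => [mf' _ _] [mg' _ _].
  apply/measurable_EFinP; apply: measurableT_comp => //.
  exact: measurable_funB.
- exact: emeasurable_funD.
- move=> y _; rewrite -EFinD lee_fin [X in _ <= X + _]distrC.
  exact: ler_distD.
Qed.

Lemma no_L1_consistent_bv :
  ~ L1_consistent Phi (\bigcup_(f in bv_densities R) sequences_with_density f).
Proof.
move=> consistent.
have error_cvg f x : bv_densities R f -> limiting_density x f ->
    exists N : nat, forall n, (N <= n)%N -> (L1_error f x n <= (1 / 8)%:E)%E.
  move=> bvf xf; apply: cvge0_eventually_le; first by lra.
  by apply: consistent => //; exists f.
have [Y HY] := cosine_quantiles R.
pose f k : R -> R := cosine_density k \_ `[0, 1].
have [x [close tail]] : exists x : nat -> R,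
    (forall k, exists2 n, (k < n)%N & (L1_error (f k) x n <= (1 / 8)%:E)%E) /\
    (forall K, exists N, forall i, (N <= i)%N ->
       exists2 l, (K <= l)%N & x i = Y l i).
  apply: (@splice_diagonal _ Y
            (fun k x n => (L1_error (f k) x n <= (1 / 8)%:E)%E)).
    by move=> k x x' n /L1_error_prefix ->.
  move=> k x n.
  (* From index n on the spliced sequence consists of exact quantiles of the k-th cosine density, so
     consistency forces a small error at some later time. *)
  have [|N HN] := error_cvg (f k) (splice x n (Y k)) (cosine_density_bv R k).
    apply: (limiting_density_unit_interval (smooth_cdf_cosine R k)) => e e0.
    exists n => i ni; rewrite /splice ltnNge ni /=.
    by have [y01 ->] := HY k i; rewrite subrr normr0; split=> //; exact: ltW.
  by exists (maxn n.+1 N); [exact: leq_maxl|apply: HN; exact: leq_maxr].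
have [|N HN] := error_cvg (@uniform_density R) x (uniform_density_bv R).
  apply: (limiting_density_unit_interval (smooth_cdf_id R)) => e e0.
  (* Late terms come from stages l >= K, where 1 / (l + 1) <= e. *)
  have [K HK] := archimedean_natP 1 e0; have [N HN] := tail K.
  exists N => i /HN[l Kl ->]; have [y01 Fy] := HY l i; split=> //.
  rewrite -Fy distrC; apply: (le_trans (cosine_cdf_near _ _)).
  by rewrite -div1r ler_pdivrMr // mulrC; apply: HK; exact: leqW.
(* Stage N yields a time n > N at which the errors for the N-th cosine density and for the uniform
   density are both at most 1/8, against a distance of at least 1/2. *)
have [n Nn en] := close N.
have n0 : (0 < n)%N by exact: leq_ltn_trans Nn.
have [df _ _] := cosine_density_bv R N; have [du _ _] := uniform_density_bv R.
have := le_trans (cosine_density_far R N) (L1_error_triangle x n0 df du).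
move=> /le_trans/(_ (leeD en (HN n (ltnW Nn)))).
by rewrite -EFinD lee_fin; lra.
Qed.

End no_consistent_scheme.

Theorem theorem2 (R : realType) :
  (~ exists Phi : density_scheme R,
       L1_consistent Phi
         (\bigcup_(f in bv_densities R) sequences_with_density f)) /\
  (~ exists Phi : density_scheme R,
       L1_consistent Phi (stationary_sequences R)).
Proof.
split=> [[Phi /no_L1_consistent_bv]//|[Phi consistent]].
(* Consistency on all stationary sequences restricts to those with a density of bounded
   variation. *)
apply: (@no_L1_consistent_bv R Phi) => x [f _ xf].
by apply: consistent; exists f.
Qed.
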